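(* Let $i\geq 4$, let $G$ be a claw-o-heavy and $P_i$-c-heavy graph, and let $x$ be a c-eligible vertex of $G$. Then $G'_x$ is $P_i$-c-heavy.
   Context: All graphs are finite and simple. For a graph $G$ on $n=|V(G)|$ vertices, a vertex $v$ is heavy if $d_G(v)\geq n/2$; a pair $\{u,v\}$ is a heavy pair of $G$ if $uv\notin E(G)$ and $d_G(u)+d_G(v)\geq n$. $G$ is claw-o-heavy if every induced $K_{1,3}$ of $G$ contains a heavy pair of $G$. For a graph $S$, $G$ is $S$-c-heavy if for every induced subgraph $G'$ of $G$ isomorphic to $S$ and every maximal clique $C$ of $G'$, every component of $G'-C$ with at least two vertices contains a vertex heavy in $G$. $P_i$ is the path on $i$ vertices. For a vertex $x$ of $G$, $G'_x$ (the completion of $G$ at $x$) is the graph on $V(G)$ obtained from $G$ by adding all missing edges $uv$ with $u,v\in N_G(x)$; heaviness in $G'_x$ is measured by degrees in $G'_x$ with the same $n$. For a claw-o-heavy $G$ and $x\in V(G)$, let $G^*$ be the graph obtained from $G$ by adding all missing edges $uv$ with $u,v\in N_G(x)$ and $\{u,v\}$ a heavy pair of $G$. The vertex $x$ is c-eligible if $N_G(x)$ is not a clique of $G$ and either (1) $G^*[N_G(x)]$ is connected, or (2) $G^*[N_G(x)]$ consists of two disjoint cliques $C_1,C_2$ and there is a vertex $z$ such that $\{x,z\}$ is a heavy pair of $G$ and $zy_1,zy_2\in E(G)$ for some $y_1\in C_1$, $y_2\in C_2$. *)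

(* Defs.v *)
From HB Require Import structures.
From mathcomp Require Import all_boot.

Set Implicit Arguments.
Unset Strict Implicit.
Unset Printing Implicit Defensive.

Record sgraph (T : finType) := SGraph {
  adj : rel T;
  adj_sym : symmetric adj;
  adj_irr : irreflexive adj }.

Section Named.
Variables m n : nat.

Definition path_adj : rel 'I_n := fun a b => (a.+1 == b) || (b.+1 == a).

Lemma path_adj_sym : symmetric path_adj.
Proof. by move=> a b; rewrite /path_adj orbC. Qed.

Lemma path_adj_irr : irreflexive path_adj.
Proof. by move=> a; rewrite /path_adj orbb gtn_eqF. Qed.

(* P_n, the path on n vertices *)
Definition pathG : sgraph 'I_n := SGraph path_adj_sym path_adj_irr.

Definition bip_adj : rel ('I_m + 'I_n) := fun a b =>
  match a, b with inl _, inr _ | inr _, inl _ => true | _, _ => false end.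

Lemma bip_adj_sym : symmetric bip_adj.
Proof. by case=> a [] b. Qed.

Lemma bip_adj_irr : irreflexive bip_adj.
Proof. by case. Qed.

(* K_{m,n} *)
Definition bipG : sgraph ('I_m + 'I_n)%type := SGraph bip_adj_sym bip_adj_irr.

End Named.

Definition clawG := bipG 1 3.

Section Graph.
Variables (T : finType) (G : sgraph T).

Definition nbh (v : T) : {set T} := [set u | adj G v u].

Definition deg (v : T) : nat := #|nbh v|.

Definition heavy (v : T) : bool := #|T| <= 2 * deg v.

Definition heavy_pair (u v : T) : bool :=
  [&& u != v, ~~ adj G u v & #|T| <= deg u + deg v].

Definition clique (C : {set T}) : bool :=
  [forall u in C, forall v in C, (u != v) ==> adj G u v].

(* The edges of the induced subgraph G[A], as a relation on all of T *)
Definition ind_adj (A : {set T}) : rel T :=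
  fun u v => [&& u \in A, v \in A & adj G u v].

(* G[A] is connected (vacuously so for A = set0) *)
Definition connected (A : {set T}) : bool :=
  [forall u in A, forall v in A, connect (ind_adj A) u v].

(* The vertex sets of the components of G[A] *)
Definition components (A : {set T}) : {set {set T}} :=
  [set [set v in A | connect (ind_adj A) u v] | u in A].

(* C is a maximal clique of G[A] *)
Definition max_clique_in (A C : {set T}) : bool :=
  maxset (fun B => (B \subset A) && clique B) C.

(* G[A] is isomorphic to S *)
Definition induces (U : finType) (S : sgraph U) (A : {set T}) : Prop :=
  exists f : U -> T,
    [/\ injective f, f @: [set: U] = A
      & forall a b, adj G (f a) (f b) = adj S a b].

Definition claw_o_heavy : Prop :=
  forall A : {set T}, induces clawG A ->
  exists u v : T, [/\ u \in A, v \in A & heavy_pair u v].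

(* Deleting C from G[A] gives G[A :\: C]. *)
Definition c_heavy (U : finType) (S : sgraph U) : Prop :=
  forall A : {set T}, induces S A ->
  forall C : {set T}, max_clique_in A C ->
  forall K : {set T}, K \in components (A :\: C) -> 2 <= #|K| ->
  exists2 v : T, v \in K & heavy v.

(* G[A] is the disjoint union of two nonempty cliques C1 and C2 *)
Definition two_cliques (A C1 C2 : {set T}) : Prop :=
  [/\ C1 != set0 /\ C2 != set0,
      [disjoint C1 & C2],
      C1 :|: C2 = A,
      clique C1 /\ clique C2
    & {in C1 & C2, forall u v, ~~ adj G u v}].

Variable x : T.

Definition completion_adj : rel T := fun u v =>
  adj G u v || [&& u \in nbh x, v \in nbh x & u != v].

Lemma completion_adj_sym : symmetric completion_adj.
Proof.
by move=> u v; rewrite /completion_adj (adj_sym G) (eq_sym u) andbCA.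
Qed.

Lemma completion_adj_irr : irreflexive completion_adj.
Proof. by move=> u; rewrite /completion_adj (adj_irr G) eqxx !andbF. Qed.

(* G'_x *)
Definition completion : sgraph T :=
  SGraph completion_adj_sym completion_adj_irr.

Definition star_adj : rel T := fun u v =>
  adj G u v || [&& u \in nbh x, v \in nbh x & heavy_pair u v].

Lemma star_adj_sym : symmetric star_adj.
Proof.
move=> u v; rewrite /star_adj /heavy_pair.
by rewrite (adj_sym G u v) (eq_sym u) (addnC (deg u)) andbCA.
Qed.

Lemma star_adj_irr : irreflexive star_adj.
Proof.
by move=> u; rewrite /star_adj /heavy_pair (adj_irr G) eqxx !andbF.
Qed.

(* G^*, relative to x *)
Definition star : sgraph T := SGraph star_adj_sym star_adj_irr.

End Graph.

Definition c_eligible (T : finType) (G : sgraph T) (x : T) : Prop :=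
  ~~ clique G (nbh G x) /\
  (connected (star G x) (nbh G x) \/
   exists C1 C2 : {set T}, two_cliques (star G x) (nbh G x) C1 C2 /\
     exists z y1 y2 : T,
       [/\ heavy_pair G x z, y1 \in C1, y2 \in C2, adj G z y1 & adj G z y2]).

(* Main.v *)
Require Import Defs.
From mathcomp Require Import all_boot.
From mathcomp Require Import zify.

(** For [4 <= i], being [P_i]-c-heavy means that every induced [P_i] has a heavy
    vertex among its first two vertices (and, reversing it, among its last two).
    Let [p_0 ... p_(i-1)] be an induced path of the completion [G'] at [x] that
    is not induced in [G].  As [N[x]] is a clique of [G'], the path has exactly
    one new edge [p_k p_(k+1)], and inserting [x] in it gives an induced path of
    [G].  If [0 < k] this longer path still starts with [p_0 p_1].  If [k = 0] it
    starts with [p_0 x], and when [x] is heavy in [G] so is [p_0] in [G'], since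
    [N_G[x]] is contained in [N_G'[p_0]]. *)

Set Implicit Arguments.
Unset Strict Implicit.
Unset Printing Implicit Defensive.

(* The values of [p] at indices [>= n] are irrelevant. *)
Definition induced_path (T : finType) (G : sgraph T) (n : nat) (p : nat -> T) :=
  forall a b, a < n -> b < n -> adj G (p a) (p b) = (a.+1 == b) || (b.+1 == a).

(** * Induced paths and [P_n]-c-heaviness *)

Section InducedPaths.
Variables (T : finType) (G : sgraph T).
Implicit Types (n a b k : nat) (p : nat -> T) (A C K : {set T}).

(** The vertices of a path on at least four vertices have pairwise distinct neighbourhoods; the two
    ends of [P_3] do not. *)
Lemma induced_path_inj n p a b : 4 <= n -> induced_path G n p ->
  a < n -> b < n -> p a = p b -> a = b.
Proof.
move=> n4 pP.
wlog lt_ab : a b / a < b.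
  move=> H an bn E; case: (ltngtP a b) => // lt.
    exact: H.
  by apply/esym/H.
move=> an bn E.
(* Adjacent indices of [a] and [b] coincide, which is impossible for [n >= 4]. *)
have row c : c < n ->
    ((a.+1 == c) || (c.+1 == a)) = ((b.+1 == c) || (c.+1 == b)).
  by move=> cn; rewrite -!pP // E.
have r1 := row a.+1 ltac:(lia).
have r2 := row a.-1 ltac:(lia).
have r3 := row 3 n4.
lia.
Qed.

Lemma induced_path_rev n p :
  induced_path G n p -> induced_path G n (fun a => p (n - a.+1)).
Proof. by move=> pP a b an bn; rewrite pP; lia. Qed.

Lemma induced_path_leq m n p :
  m <= n -> induced_path G n p -> induced_path G m p.
Proof. by move=> mn pP a b am bm; rewrite pP //; lia. Qed.

Lemma inducesP n A : 4 <= n ->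
  induces G (pathG n) A <->
  exists2 p, induced_path G n p & A = [set p a | a : 'I_n].
Proof.
move=> n4; split=> [[f [_ fA fadj]]|[p pP ->]].
  have n0 : 0 < n by lia.
  pose o := Ordinal n0.
  exists (fun a => f (insubd o a)) => [a b an bn|].
    by rewrite fadj /= /path_adj !val_insubd an bn.
  rewrite -fA; apply/setP=> v; apply/imsetP/imsetP => -[a _ ->]; exists a => //.
    by rewrite valKd.
  by rewrite valKd.
exists (fun a : 'I_n => p a); split=> [a b E||a b].
- by apply: val_inj; apply: (induced_path_inj n4 pP _ _ E).
- by apply/setP=> v; apply/imsetP/imsetP => -[a _ ->]; exists a.
- by rewrite pP.
Qed.

Lemma ind_adj_sym A : symmetric (ind_adj G A).
Proof. by move=> u v; rewrite /ind_adj (adj_sym G) andbCA. Qed.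

Lemma closed_connect_sub A K u : u \in K ->
  (forall v w, v \in K -> ind_adj G A v w -> w \in K) ->
  forall v, connect (ind_adj G A) u v -> v \in K.
Proof.
move=> uK clK v uv; rewrite -(closed_connect _ uv) //.
by apply: (intro_closed (sym_connect_sym (@ind_adj_sym A))) => s t st /clK; apply.
Qed.

(** The edge [p 2], [p 3] is a maximal clique, and deleting it leaves [p 0], [p 1] as a
    component. *)
Lemma c_heavy_path_start n p : 4 <= n -> c_heavy G (pathG n) ->
  induced_path G n p -> heavy G (p 0) || heavy G (p 1).
Proof.
move=> n4 cG pP.
have pI a b : a < n -> b < n -> p a = p b -> a = b.
  exact: induced_path_inj n4 pP.
have AP : induces G (pathG n) [set p a | a : 'I_n] by apply/inducesP => //; exists p.
set A := [set p a | a : 'I_n] in AP.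
have pA a : a < n -> p a \in A.
  by move=> an; apply/imsetP; exists (Ordinal an).
pose C := [set p 2; p 3].
have Cmax : max_clique_in G A C.
  apply/maxsetP; split=> [|B /andP[/subsetP BA /forall_inP cB] CB].
    apply/andP; split.
      by apply/subsetP=> v /set2P[] ->; apply: pA; lia.
    apply/forall_inP=> u /set2P uC; apply/forall_inP=> v /set2P vC.
    apply/implyP; case: uC => ->; case: vC => ->; rewrite ?eqxx // pP //; lia.
  apply/eqP; rewrite eqEsubset CB andbT; apply/subsetP=> v vB.
  have [a _ Ea] := imsetP (BA v vB); subst v; have an := ltn_ord a.
  (* A further vertex of a larger clique would be adjacent to both [p 2] and [p 3], but an induced
     path has no triangle. *)
  have near c : c < n -> p c \in C -> a <> c :> nat -> (a.+1 == c) || (c.+1 == a).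
    move=> cn cC ac; rewrite -pP //.
    have /forall_inP/(_ _ (subsetP CB _ cC))/implyP := cB _ vB.
    by apply; apply/eqP => /(pI _ _ an cn).
  have n2 := near 2 ltac:(lia) (set21 _ _).
  have n3 := near 3 ltac:(lia) (set22 _ _).
  have [->|a2] := eqVneq (a : nat) 2; first exact: set21.
  have [->|a3] := eqVneq (a : nat) 3; first exact: set22.
  lia.
pose K := [set p 0; p 1].
have pD a : a < 2 -> p a \in A :\: C.
  move=> a2; rewrite in_setD pA ?andbT; last by lia.
  by apply/set2P=> -[] /pI; lia.
have KD : K \in components G (A :\: C).
  apply/imsetP; exists (p 0); first exact: pD.
  apply/setP=> v; rewrite inE; apply/set2P/andP=> [[] ->|[_ v0]].
  - by rewrite pD // connect0.
  - by rewrite pD // connect1 // /ind_adj !pD // pP //; lia.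
  apply/set2P; apply: (closed_connect_sub _ _ v0); first exact: set21.
  move=> {v0}v w vK /and3P[_ /setDP[/imsetP[a _ ->] aC] vw].
  have an := ltn_ord a.
  have a2 : a <> 2 :> nat by move=> E; rewrite E set21 in aC.
  have : a < 2.
    by case/set2P: vK vw => ->; rewrite pP //; lia.
  case: (nat_of_ord a) => [|[|//]] _; [exact: set21 | exact: set22].
have K2 : 2 <= #|K|.
  by rewrite cards2; case: eqP => // /pI; lia.
have [v /set2P[] -> ->] := cG _ AP _ Cmax _ KD K2; by rewrite ?orbT.
Qed.

(** With nothing deleted up to [p a], its component runs down to [p 0]. It could miss [p 1] only if
    [p 1] is deleted, and then it would be [p 0] alone. *)
Lemma path_component_start n p C K a :
  let A := [set p b | b : 'I_n] in
  2 <= n -> induced_path G n p -> a < n ->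
  (forall b, b <= a -> p b \notin C) ->
  K = [set v in A :\: C | connect (ind_adj G (A :\: C)) (p a) v] ->
  2 <= #|K| -> p 0 \in K /\ p 1 \in K.
Proof.
move=> A n2 pP an aC -> K2.
have pA b : b < n -> p b \in A.
  by move=> bn; apply/imsetP; exists (Ordinal bn).
set D := A :\: C in K2 *.
have csym := sym_connect_sym (@ind_adj_sym D).
have pD b : b <= a -> p b \in D.
  by move=> ba; rewrite in_setD aC // pA //; lia.
have down b : b <= a -> connect (ind_adj G D) (p 0) (p b).
  elim: b => [|b IH] ba; first exact: connect0.
  apply: connect_trans (IH (ltnW ba)) (connect1 _).
  by rewrite /ind_adj !pD ?pP //; lia.
have p0 : connect (ind_adj G D) (p a) (p 0) by rewrite csym down.
rewrite !inE -!in_setD p0 andbT pD //; split=> //.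
case p1C : (p 1 \in C); last first.
  have p1D : p 1 \in D by rewrite in_setD p1C pA.
  rewrite p1D; apply: connect_trans p0 (connect1 _).
  by rewrite /ind_adj p1D pD // pP //; lia.
have a0 : a = 0.
  by case: a aC {an pD down p0 K2} => // a /(_ 1 isT); rewrite p1C.
move: K2; rewrite leqNgt ltnS => /negP[].
rewrite -(cards1 (p 0)); apply: subset_leq_card.
apply/subsetP=> v; rewrite !inE a0 => /andP[_ v0].
rewrite -in_set1; apply: (closed_connect_sub _ _ v0); first exact: set11.
move=> {v0} {}v w /set1P-> /and3P[_ /setDP[/imsetP[b _ ->] bC]].
rewrite pP //; last by lia.
move=> b1; suff E : nat_of_ord b = 1 by rewrite E p1C in bC.
lia.
Qed.

(** A clique holds at most two vertices of the path, and two must be consecutive, so it cannot meet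
    both sides of a remaining vertex [p a]. On a side it misses, the component of [p a] reaches the
    end of the path. *)
Lemma c_heavy_pathI n : 4 <= n ->
  (forall p, induced_path G n p -> heavy G (p 0) || heavy G (p 1)) ->
  c_heavy G (pathG n).
Proof.
move=> n4 H A /(inducesP _ n4)[p pP AE] C /maxsetp/andP[_ /forall_inP cC] K.
case/imsetP=> u /setDP[uA uC] KE K2.
have start q : induced_path G n q -> q 0 \in K /\ q 1 \in K ->
    exists2 v, v \in K & heavy G v.
  by move=> /H/orP[]hq [q0 q1]; [exists (q 0) | exists (q 1)].
move: uA; rewrite AE => /imsetP[a _ ua]; have an := ltn_ord a.
have [/existsP[c /andP[ca pcC]]|noC] :=
  boolP [exists c : 'I_n, (c < a) && (p c \in C)].
  (* [C] meets the path below [a], hence not above: read the path backwards. *)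
  apply: (start _ (induced_path_rev pP)).
  have AE' : A = [set p (n - b.+1) | b : 'I_n].
    rewrite AE; apply/setP=> v; apply/imsetP/imsetP => -[b _ ->];
      exists (rev_ord b) => //=; congr p; have := ltn_ord b; lia.
  have aE : n - (n - a.+1).+1 = a by lia.
  apply: (@path_component_start n (fun b => p (n - b.+1)) C K (n - a.+1)) => //.
  - by lia.
  - exact: induced_path_rev.
  - by lia.
  - move=> b ba; apply/negP=> bC.
    have [Eb|nb] := eqVneq (n - b.+1) a; first by rewrite Eb -ua (negbTE uC) in bC.
    (* Here [c < a < n - b.+1], so two vertices of the clique [C] are distinct and non-consecutive
       on the path. *)
    have /forall_inP/(_ _ bC)/implyP := cC _ pcC.
    have cn := ltn_ord c.
    case: eqP => [/(induced_path_inj n4 pP)|_ /(_ isT)]; first by lia.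
    by rewrite pP; lia.
  - by rewrite /= -AE' aE -ua.
apply: (start _ pP).
apply: (@path_component_start n p C K a) => //; first by lia.
  move=> b; rewrite leq_eqVlt => /predU1P[->|ba]; first by rewrite -ua.
  apply: contra noC => bC; apply/existsP.
  by exists (Ordinal (ltn_trans ba an)); rewrite ba.
by rewrite -AE -ua.
Qed.

End InducedPaths.

(** * Induced paths of the completion *)

Section Completion.
Variables (T : finType) (G : sgraph T) (x : T).

Lemma heavy_completion v : heavy G v -> heavy (completion G x) v.
Proof.
move/leq_trans; apply; rewrite leq_mul2l /=; apply: subset_leq_card.
by apply/subsetP=> u; rewrite !inE /= /completion_adj => ->.
Qed.

Lemma heavy_completion_nbh v :
  v \in nbh G x -> heavy G x -> heavy (completion G x) v.
Proof.
move=> vx /leq_trans; apply; rewrite leq_mul2l /=.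
(* [v] counts once in [nbh G x] and [x] once in the new neighbourhood of [v]; removing both leaves
   an inclusion. *)
rewrite /deg (cardsD1 v) vx.
have xv : x \in nbh (completion G x) v.
  by move: vx; rewrite !inE /= /completion_adj (adj_sym G x v) => ->.
rewrite (cardsD1 x (nbh _ v)) xv leq_add2l; apply: subset_leq_card.
apply/subsetP=> u; rewrite !inE => /andP[uv ux]; apply/andP; split.
  by apply: contraTneq ux => ->; rewrite adj_irr.
by move: vx; rewrite /= /completion_adj !inE ux (eq_sym v u) uv => ->; rewrite orbT.
Qed.

Section NewEdge.
Variables (n k : nat) (p : nat -> T).
Hypotheses (n4 : 4 <= n) (pP : induced_path (completion G x) n p).
Hypotheses (kn : k.+1 < n) (newk : ~~ adj G (p k) (p k.+1)).

Lemma new_edge_nbh : p k \in nbh G x /\ p k.+1 \in nbh G x.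
Proof.
have : adj (completion G x) (p k) (p k.+1) by rewrite pP ?eqxx // ltnW.
by rewrite /= /completion_adj (negbTE newk) => /and3P[].
Qed.

(** In the completion, a neighbour of [x] on the path is equal or adjacent to each of [p k] and
    [p k.+1]; a third one would close a triangle. *)
Lemma new_edge_adj_center a : a < n -> adj G x (p a) = (a == k) || (a == k.+1).
Proof.
have [xk xk1] := new_edge_nbh.
move=> an; apply/idP/orP=> [xa|[] /eqP->]; last 2 first.
- by rewrite inE in xk.
- by rewrite inE in xk1.
have near c : c < n -> p c \in nbh G x -> a = c \/ a.+1 = c \/ c.+1 = a.
  move=> cn xc; have [|ac] := eqVneq (p a) (p c).
    by move/(induced_path_inj n4 pP an cn); left.
  have : adj (completion G x) (p a) (p c).
    by rewrite /= /completion_adj [p a \in _]inE xa xc ac orbT.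
  by rewrite pP //; lia.
have := near k ltac:(lia) xk; have := near _ kn xk1; lia.
Qed.

(** An edge absent from [G] joins two neighbours of [x], and on the path these are only [p k] and
    [p k.+1]. *)
Lemma new_edge_adj a b : a < n -> b < n -> adj G (p a) (p b) =
  (a.+1 == b) && (a != k) || (b.+1 == a) && (b != k).
Proof.
move=> an bn; have := pP an bn; rewrite /= /completion_adj !inE.
rewrite !new_edge_adj_center //.
case ab : (adj G (p a) (p b)) => /= E; last first.
  case: (p a =P p b) E => [/(induced_path_inj n4 pP an bn) ->|_]; lia.
have ak : ~ (a = k /\ b = k.+1).
  by case=> Ea Eb; move: ab; rewrite Ea Eb (negbTE newk).
have bk : ~ (b = k /\ a = k.+1).
  by case=> Eb Ea; move: ab; rewrite Ea Eb adj_sym (negbTE newk).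
lia.
Qed.

(** That [x] is not already on the path follows from these adjacencies, by [induced_path_inj]. *)
Lemma induced_path_insert : induced_path G n.+1
  (fun a => if a <= k then p a else if a == k.+1 then x else p a.-1).
Proof.
move=> a b an bn.
case: (leqP a k) => ak; case: (leqP b k) => bk;
  try case: (a =P k.+1) => ak1; try case: (b =P k.+1) => bk1;
  rewrite ?adj_irr ?(adj_sym G _ x) ?new_edge_adj_center ?new_edge_adj; lia.
Qed.

End NewEdge.

Lemma completion_path_start n p : 4 <= n -> c_heavy G (pathG n) ->
  induced_path (completion G x) n p ->
  heavy (completion G x) (p 0) || heavy (completion G x) (p 1).
Proof.
move=> n4 cG pP.
have [/existsP[k /andP[kn newk]]|old] :=
  boolP [exists k : 'I_n, (k.+1 < n) && ~~ adj G (p k) (p k.+1)].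
  (* The longer path has [n.+1] vertices; dropping its last one gives an induced [P_n] of [G]. *)
  have := c_heavy_path_start n4 cG
    (induced_path_leq (leqnSn n) (induced_path_insert n4 pP kn newk)).
  have [xk _] := new_edge_nbh pP kn newk.
  cbv beta; rewrite leq0n; case: (posnP k) => [k0|_ /orP[]/heavy_completion->];
    rewrite ?orbT // k0 /=.
  rewrite k0 in xk.
  by case/orP=> [/heavy_completion|/(heavy_completion_nbh xk)] ->.
have edge a : a.+1 < n -> adj G (p a) (p a.+1).
  move=> an; apply: contraR old => na; apply/existsP.
  by exists (Ordinal (ltnW an)); rewrite /= an.
(* Non-consecutive vertices are non-adjacent in the completion, hence in [G]. *)
have qP : induced_path G n p.
  move=> a b an bn; apply/idP/idP=> [ab|/orP[]/eqP E].
  - by rewrite -pP //= /completion_adj ab.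
  - by rewrite -E edge ?E.
  - by rewrite -E adj_sym edge ?E.
by have /orP[/heavy_completion->|/heavy_completion->] :=
  c_heavy_path_start n4 cG qP; rewrite ?orbT.
Qed.

End Completion.

Theorem theorem12 (T : finType) (G : sgraph T) (i : nat) (x : T)
    (hi : 4 <= i)
    (hclaw : claw_o_heavy G)
    (hpath : c_heavy G (pathG i))
    (hx : c_eligible G x) :
  c_heavy (completion G x) (pathG i).
Proof.
by apply: c_heavy_pathI => // p; apply: completion_path_start.
Qed.
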